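(* The monoid $M_3(\mathbb{Z}_{\max})$ is minimally and irredundantly generated by the matrices $$A = A_1(1)P_{(1,2)},\quad B = A_1(-1)P_{(1,2,3)},\quad E_{12},\quad A_1(-\infty),\quad\text{and } Z_3(i) \text{ for } i \in \mathbb{N}_0.$$
   Context: $\mathbb{N}_0$ is the set of non-negative integers. $\mathbb{Z}_{\max} = \mathbb{Z}\cup\{-\infty\}$ is the tropical integer semiring, with semiring addition $\max$ and semiring multiplication the usual addition; its semiring zero is $-\infty$ and its semiring one is $0$. $M_3(\mathbb{Z}_{\max})$ is the monoid of all $3\times 3$ matrices over $\mathbb{Z}_{\max}$ under (tropical) matrix multiplication. $A_1(\lambda)$ is the $3\times 3$ matrix with diagonal $(\lambda,0,0)$ and $-\infty$ off the diagonal. $E_{12}$ is the $3\times 3$ matrix with diagonal entries $0$, $(1,2)$ entry $0$, and all other entries $-\infty$. For a permutation $\sigma$ of $\{1,2,3\}$, $P_\sigma$ is the permutation matrix of $\sigma$: its $(i,j)$ entry is $0$ if $j=\sigma(i)$ and $-\infty$ otherwise; $(1,2)$ and $(1,2,3)$ denote permutations in cycle notation. For $s\in\mathbb{Z}$, $$Z_3(s) = \begin{pmatrix} 0 & 0 & -\infty \\ -\infty & 0 & 0 \\ s & -\infty & 0\end{pmatrix}.$$ A subset $X$ of a semigroup $\mathcal{S}$ is a generating set if $\mathcal{S}$ is the smallest subsemigroup containing $X$. It is minimal if $|X|\le |Y|$ (as cardinals) for every generating set $Y$ of $\mathcal{S}$, and irredundant if for each $x\in X$, $X \setminus\{x\}$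 is not a generating set. ''Minimally and irredundantly generated by $X$'' means $X$ is a minimal and irredundant generating set. *)

(* Defs.v *)
From HB Require Import structures.
From mathcomp Require Import all_boot all_order all_fingroup all_algebra.
From mathcomp Require Import boolp classical_sets functions cardinality.

Set Implicit Arguments.
Unset Strict Implicit.
Unset Printing Implicit Defensive.

Import Order.TTheory GRing.Theory Num.Theory.
Local Open Scope classical_set_scope.
Local Open Scope ring_scope.

(** [Some n] is the integer [n] and [None] is -oo. Beware that in [ring_scope]
    the semiring constants [0] and [1] of [Zmax] are -oo and the integer 0. *)
Definition Zmax : Type := option int.

Notation ninf := (None : Zmax).
Notation fin n := (Some (n : int) : Zmax).

Definition zmax_add (x y : Zmax) : Zmax :=
  match x, y with
  | None, _ => y
  | _, None => x
  | Some m, Some n => Some (Num.max m n)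
  end.

Definition zmax_mul (x y : Zmax) : Zmax :=
  match x, y with
  | Some m, Some n => Some (m + n)
  | _, _ => None
  end.

Fact zmax_addA : associative zmax_add.
Proof. by case=> [m|] [n|] [p|] //=; rewrite maxA. Qed.

Fact zmax_addC : commutative zmax_add.
Proof. by case=> [m|] [n|] //=; rewrite maxC. Qed.

Fact zmax_add0 : left_id ninf zmax_add.
Proof. by case. Qed.

Fact zmax_mulA : associative zmax_mul.
Proof. by case=> [m|] [n|] [p|] //=; rewrite addrA. Qed.

Fact zmax_mulC : commutative zmax_mul.
Proof. by case=> [m|] [n|] //=; rewrite addrC. Qed.

Fact zmax_mul1 : left_id (fin 0) zmax_mul.
Proof. by case=> [m|] //=; rewrite add0r. Qed.

Fact zmax_mulDl : left_distributive zmax_mul zmax_add.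
Proof. by case=> [m|] [n|] [p|] //=; rewrite addr_maxl. Qed.

Fact zmax_mul0 : left_zero ninf zmax_mul.
Proof. by []. Qed.

HB.instance Definition _ := Countable.copy Zmax (option int).
HB.instance Definition _ :=
  GRing.isNmodule.Build Zmax zmax_addA zmax_addC zmax_add0.
HB.instance Definition _ := GRing.Nmodule_isComNzSemiRing.Build Zmax
  zmax_mulA zmax_mulC zmax_mul1 zmax_mulDl zmax_mul0 isT.

Section Generation.
Context {T : Type} (op : SemiGroup.law T).

Definition subsemigroup (S : set T) : Prop :=
  forall x y, S x -> S y -> S (op x y).

Definition generating (X : set T) : Prop := smallest subsemigroup X = [set: T].

Definition minimal_generating (X : set T) : Prop :=
  generating X /\ forall Y : set T, generating Y -> (X #<= Y)%card.

Definition irredundant_generating (X : set T) : Prop :=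
  generating X /\ forall x, X x -> ~ generating (X `\ x).

Definition minimally_irredundantly_generated_by (X : set T) : Prop :=
  minimal_generating X /\ irredundant_generating X.

End Generation.

Definition mx3 (rows : seq (seq Zmax)) : 'M[Zmax]_3 :=
  \matrix_(i < 3, j < 3) nth ninf (nth [::] rows i) j.

Definition A1 (l : Zmax) : 'M[Zmax]_3 :=
  mx3 [:: [:: l;    ninf;  ninf ];
          [:: ninf; fin 0; ninf ];
          [:: ninf; ninf;  fin 0]].

Definition E12 : 'M[Zmax]_3 :=
  mx3 [:: [:: fin 0; fin 0; ninf ];
          [:: ninf;  fin 0; ninf ];
          [:: ninf;  ninf;  fin 0]].

Definition Z3 (s : int) : 'M[Zmax]_3 :=
  mx3 [:: [:: fin 0; fin 0; ninf ];
          [:: ninf;  fin 0; fin 0];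
          [:: fin s; ninf;  fin 0]].

(** Indices are 0-based: the transposition (1,2) swaps [0] and [1], and the
    cycle (1,2,3) is the cyclic successor [ordS] of ['I_3]. *)
Definition cycle12 : 'S_3 := tperm 0 1.
Definition cycle123 : 'S_3 := perm (@ordS_inj 3).

Fact perm_mxE (s : 'S_3) (i j : 'I_3) :
  (perm_mx s : 'M[Zmax]_3) i j = if j == s i then fin 0 else ninf.
Proof. by rewrite !mxE eq_sym; case: (_ == _). Qed.

Definition matA : 'M[Zmax]_3 := A1 (fin 1) *m perm_mx cycle12.
Definition matB : 'M[Zmax]_3 := A1 (fin (-1)) *m perm_mx cycle123.

(* Main.v *)
Require Import Defs.
From HB Require Import structures.
From mathcomp Require Import all_boot all_order all_fingroup all_algebra.
From mathcomp Require Import boolp classical_sets functions cardinality.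
From mathcomp Require Import zify.

(** The proof rests on two ideas, one for generating and one for the lower
    bound.

    Generating. The monomial matrices (one finite entry in each row and
    column) are the units of the monoid, and words in [matA] and [matB] give
    them all ([monomial_generated]). So every matrix can be considered up to
    multiplication by monomial matrices on both sides (the relation [assoc]);
    up to [assoc] the matrix [E12] stands for all transvections and [A1 ninf]
    for all ways of erasing one row. If the support of a nonzero column is
    contained in the support of another one, a suitable multiple of the former
    lies below the latter and touches it, so the touching entries can be
    cleared and restored by a transvection ([column_reduction]); this writes
    the matrix as a product of one with fewer finite entries and a
    transvection, and transposition does the same for rows. When no such step is
    possible, a short combinatorial argument on the nine entries
    ([incomparable_cases]) leaves two shapes: partial monomial matrices, which
    are products of a monomial matrix and row erasures, and matrices whose -oo
    entries form a permutation matrix. Rescaling brings the latter to [Z3 r]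
    for an integer [r], and exchanging the two permutations in its support
    replaces [r] by [- r], so that [r] may be taken to be nonnegative.

    Lower bound. Call a set [C] of matrices prime when [M * N] lies in [C]
    only if [M] or [N] does; equivalently, its complement is a subsemigroup.
    Every generating set meets every nonempty prime set ([generating_meets]).
    Five kinds of prime sets separate the generators: the monomial matrices of
    positive total weight ([matA] only), those of negative total weight
    ([matB] only), the matrices with a row of -oo ([A1 ninf] only), and the
    [assoc]-classes of [E12] and of each [Z3 r]. This gives irredundancy, and
    since the classes of the matrices [Z3 r] are pairwise disjoint, every
    generating set is infinite, whereas the whole monoid is countable.

    The primality of the units and of the classes of [E12] and [Z3 r] has one
    cause, [aligned_factors]. In each case the support of the product [P]
    contains the diagonal and never a pair of opposite off-diagonal positions.
    Then the diagonal entries of [P] come from pairwise distinct intermediate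
    indices, so after a permutation both factors have a finite diagonal, and
    their supports are then trapped inside that of [P]. *)

Set Implicit Arguments.
Unset Strict Implicit.
Unset Printing Implicit Defensive.
Import Order.TTheory GRing.Theory Num.Theory.
Local Open Scope classical_set_scope.
Local Open Scope ring_scope.

Local Notation mulM3 := ( *%R : SemiGroup.law 'M[Zmax]_3).

(** * Supports of products *)

Lemma zmax_mulf_neq0 (x y : Zmax) : (x * y != 0) = (x != 0) && (y != 0).
Proof. by case: x; case: y. Qed.

Lemma zmax_addf_neq0 (x y : Zmax) : (x + y != 0) = (x != 0) || (y != 0).
Proof. by case: x; case: y. Qed.

Lemma zmax_neq0_fin (x : Zmax) : x != 0 -> exists a : int, x = fin a.
Proof. by case: x => // a _; exists a. Qed.

(** No cancellation can occur in a sum, so the support of a product is the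
    boolean product of the supports. *)
Lemma mulmx_neq0P m n p (M : 'M[Zmax]_(m, n)) (N : 'M_(n, p)) i j :
  reflect (exists2 k, M i k != 0 & N k j != 0) ((M *m N) i j != 0).
Proof.
rewrite mxE; apply: (iffP idP) => [nz | [k Mik Nkj]]; last first.
  by rewrite (bigD1 k) //= zmax_addf_neq0 zmax_mulf_neq0 Mik Nkj.
case: (pickP (fun k => (M i k != 0) && (N k j != 0))) => [k /andP[] | z].
  by exists k.
by move: nz; rewrite big1 ?eqxx // => k _; move/negbT: (z k);
  rewrite -zmax_mulf_neq0 negbK => /eqP.
Qed.

(** * Monomial matrices *)

Definition monomx n (d : 'I_n -> int) (s : 'S_n) : 'M[Zmax]_n :=
  \matrix_(i, j) if j == s i then fin (d i) else ninf.

Lemma eq_monomx n (d e : 'I_n -> int) (s t : 'S_n) :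
  d =1 e -> s =1 t -> monomx d s = monomx e t.
Proof. by move=> de st; apply/matrixP => i j; rewrite !mxE de st. Qed.

Lemma monomx_mulmx n p (d : 'I_n -> int) (s : 'S_n) (M : 'M[Zmax]_(n, p)) i j :
  (monomx d s *m M) i j = fin (d i) * M (s i) j.
Proof.
rewrite mxE (bigD1 (s i)) //= big1 => [|k /negPf ki]; rewrite !mxE ?ki //.
by rewrite eqxx addr0.
Qed.

Lemma mulmx_monomx n p (d : 'I_n -> int) (s : 'S_n) (M : 'M[Zmax]_(p, n)) i j :
  (M *m monomx d s) i (s j) = M i j * fin (d j).
Proof.
rewrite mxE (bigD1 j) //= big1 => [|k /negPf kj]; rewrite !mxE.
  by rewrite eqxx addr0.
by rewrite (inj_eq perm_inj) eq_sym kj; case: (M i k).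
Qed.

Lemma monomxM n (d e : 'I_n -> int) (s t : 'S_n) :
  monomx d s *m monomx e t = monomx (fun i => d i + e (s i)) (s * t)%g.
Proof.
by apply/matrixP => i j; rewrite monomx_mulmx !mxE permM; case: (_ == _).
Qed.

Lemma monomx1 n : monomx (fun=> 0) 1%g = 1%:M :> 'M_n.
Proof.
by apply/matrixP => i j; rewrite !mxE perm1 eq_sym; case: (_ == _).
Qed.

Lemma monomx_inj n (d e : 'I_n -> int) (s t : 'S_n) :
  monomx d s = monomx e t -> d =1 e.
Proof.
move=> /matrixP eq_de i; move: (eq_de i (s i)); rewrite !mxE eqxx.
by case: eqP => // _ [].
Qed.

Definition monomial n (U : 'M[Zmax]_n) : Prop :=
  exists d s, U = monomx d s.

Lemma monomialM n (U V : 'M[Zmax]_n) :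
  monomial U -> monomial V -> monomial (U *m V).
Proof. by move=> [d [s ->]] [e [t ->]]; rewrite monomxM; do 2 eexists. Qed.

Lemma monomial1 n : monomial (1%:M : 'M[Zmax]_n).
Proof. by rewrite -monomx1; do 2 eexists. Qed.

Lemma monomialV n (U : 'M[Zmax]_n) : monomial U ->
  exists V, [/\ monomial V, U *m V = 1%:M & V *m U = 1%:M].
Proof.
move=> [d [s ->]]; exists (monomx (fun i => - d (s^-1 i)%g) s^-1%g).
split; first by do 2 eexists.
  by rewrite monomxM mulgV -monomx1; apply: eq_monomx => // i;
    rewrite permK subrr.
by rewrite monomxM mulVg -monomx1; apply: eq_monomx => // i; rewrite addNr.
Qed.

Lemma diag_monomial n (M : 'M[Zmax]_n) :
  (forall i, M i i != 0) -> (forall i j, M i j != 0 -> i = j) -> monomial M.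
Proof.
move=> Mii Mij; exists (fun i => odflt 0 (M i i)), 1%g.
apply/matrixP => i j; rewrite mxE perm1; case: eqP => [->|/eqP ji].
  by case/zmax_neq0_fin: (Mii i) => a ->.
by apply/eqP/negPn/negP => /Mij ij; rewrite ij eqxx in ji.
Qed.

(** * Matrices up to monomial factors *)

Definition assoc n (M N : 'M[Zmax]_n) : Prop :=
  exists U V, [/\ monomial U, monomial V & N = U *m M *m V].

Lemma assoc_refl n (M : 'M[Zmax]_n) : assoc M M.
Proof.
by exists 1%:M, 1%:M; split; [exact: monomial1 .. | rewrite mul1mx mulmx1].
Qed.

Lemma assoc_sym n (M N : 'M[Zmax]_n) : assoc M N -> assoc N M.
Proof.
move=> [U [V [/monomialV[U' [mU' _ U'U]] /monomialV[V' [mV' VV' _]] ->]]].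
exists U', V'; split=> //.
by rewrite !mulmxA U'U mul1mx -mulmxA VV' mulmx1.
Qed.

Lemma assoc_trans n (M N P : 'M[Zmax]_n) : assoc M N -> assoc N P -> assoc M P.
Proof.
move=> [U [V [mU mV ->]]] [U' [V' [mU' mV' ->]]].
exists (U' *m U), (V *m V'); split; [exact: monomialM .. |].
by rewrite !mulmxA.
Qed.

Lemma assocMl n (U M : 'M[Zmax]_n) : monomial U -> assoc M (U *m M).
Proof.
by move=> mU; exists U, 1%:M; split; rewrite ?mulmx1 //; exact: monomial1.
Qed.

Lemma assocMr n (U M : 'M[Zmax]_n) : monomial U -> assoc M (M *m U).
Proof.
by move=> mU; exists 1%:M, U; split; rewrite ?mul1mx //; exact: monomial1.
Qed.

Lemma assoc_monomial n (M N : 'M[Zmax]_n) :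
  assoc M N -> monomial M -> monomial N.
Proof. by move=> [U [V [mU mV ->]]] mM; do 2! apply: monomialM => //. Qed.

Lemma assocP n (M N : 'M[Zmax]_n) (d e : 'I_n -> int) (s t : 'S_n) :
  (forall i j, N i j = fin (d i) * M (s i) (t j) * fin (e j)) -> assoc M N.
Proof.
move=> defN; exists (monomx d s), (monomx (fun j => e (t^-1 j)%g) t^-1%g).
split; [by do 2 eexists .. |].
apply/matrixP => i j.
by rewrite -{2}(permK t j) mulmx_monomx monomx_mulmx defN /= permK.
Qed.

Lemma assoc_entries n (M N : 'M[Zmax]_n) : assoc M N ->
  exists (d e : 'I_n -> int) (s t : 'S_n), forall i j,
    N i (t j) = fin (d i) * M (s i) j * fin (e j).
Proof.
move=> [_ [_ [[d [s ->]] [e [t ->]] ->]]]; exists d, e, s, t => i j.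
by rewrite mulmx_monomx monomx_mulmx.
Qed.

(** The number of finite entries, an invariant of [assoc] that already tells
    most of the generators apart; it is also the measure for the induction
    that factors an arbitrary matrix. *)
Definition nfin n (M : 'M[Zmax]_n) : nat := (\sum_i \sum_j (M i j != 0%R))%N.

Lemma nfin_assoc n (M N : 'M[Zmax]_n) : assoc M N -> nfin M = nfin N.
Proof.
case/assoc_entries => d [e [s [t defN]]].
rewrite /nfin [LHS](reindex_perm s); apply: eq_bigr => i _.
rewrite [RHS](reindex_perm t); apply: eq_bigr => j _.
by rewrite defN !zmax_mulf_neq0 andbT.
Qed.

Lemma nfin_tr n (M : 'M[Zmax]_n) : nfin M^T = nfin M.
Proof.
by rewrite /nfin exchange_big; do 2! apply: eq_bigr => ? _; rewrite mxE.
Qed.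

Lemma nfin_monomial n (M : 'M[Zmax]_n) : monomial M -> nfin M = n.
Proof.
case=> d [s ->]; rewrite /nfin -[RHS]card_ord -sum1_card.
apply: eq_bigr => i _; rewrite (bigD1 (s i)) //= big1 => [|j /negPf ji].
  by rewrite mxE eqxx.
by rewrite mxE ji.
Qed.

(** * Generating the monomial matrices *)

Lemma ord3_ind (P : 'I_3 -> Prop) : P 0 -> P 1 -> P ord_max -> forall i, P i.
Proof.
move=> P0 P1 P2 [[|[|[|//]]] lti].
- by rewrite (_ : Ordinal lti = 0) //; apply: val_inj.
- by rewrite (_ : Ordinal lti = 1) //; apply: val_inj.
- by rewrite (_ : Ordinal lti = ord_max) //; apply: val_inj.
Qed.

Definition vec3 (a b c : int) : 'I_3 -> int := fun i => nth 0 [:: a; b; c] i.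

Lemma matAE : matA = monomx (vec3 1 0 0) cycle12.
Proof.
apply/matrixP => i j; rewrite /matA mxE.
rewrite (bigD1 i) //= big1 => [|k ki]; last first.
  by rewrite mxE; move: i k ki; do 2 elim/ord3_ind.
rewrite addr0 perm_mxE !mxE; case: eqP => _; last by rewrite mulr0.
by move: i {j}; elim/ord3_ind.
Qed.

Lemma matBE : matB = monomx (vec3 (-1) 0 0) cycle123.
Proof.
apply/matrixP => i j; rewrite /matB mxE.
rewrite (bigD1 i) //= big1 => [|k ki]; last first.
  by rewrite mxE; move: i k ki; do 2 elim/ord3_ind.
rewrite addr0 perm_mxE !mxE; case: eqP => _; last by rewrite mulr0.
by move: i {j}; elim/ord3_ind.
Qed.

Lemma cycle12E :
  (cycle12 0 = 1) * (cycle12 1 = 0) * (cycle12 ord_max = ord_max).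
Proof. by rewrite /cycle12 tpermL tpermR tpermD. Qed.

Lemma cycle123E :
  (cycle123 0 = 1) * (cycle123 1 = ord_max) * (cycle123 ord_max = 0).
Proof. by rewrite /cycle123 !permE; do ![split]; apply: val_inj. Qed.

(** Writing a monomial matrix as a diagonal of integers followed by a
    permutation, [A^2] is (1,1,0) and [B^3] is (-1,-1,-1), so [A^2 B^3] is
    (0,0,-1). The positive scalar (1,1,1) is [(A^2 B)^3]; this makes [B]
    invertible within the semigroup, and conjugation by [B] then gives the
    inverses of all the coordinate diagonals, hence, with (1,1,1), all
    diagonal matrices. Dividing [A] and [B] by their diagonals leaves a
    transposition and a 3-cycle, which generate the symmetric group. *)
Lemma monomial_generated (G : set 'M[Zmax]_3) : subsemigroup mulM3 G ->
  G matA -> G matB -> forall M, monomial M -> G M.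
Proof.
move=> closedG; rewrite matAE matBE => GA GB M [d [s ->]].
have mulG d1 s1 d2 s2 d3 (s3 : 'S_3) : G (monomx d1 s1) -> G (monomx d2 s2) ->
    (forall i, d1 i + d2 (s1 i) = d3 i) -> (forall i, s2 (s1 i) = s3 i) ->
    G (monomx d3 s3).
  move=> G1 G2 eqd eqs; have: G (_ *m _) := closedG _ _ G1 G2; rewrite monomxM.
  by rewrite (@eq_monomx _ _ d3 _ s3) // => i; rewrite permM eqs.
pose c2 := (cycle123 * cycle123)%g.
have c2E : (c2 0 = ord_max) * (c2 1 = 0) * (c2 ord_max = 1).
  by rewrite !permM !cycle123E.
have GAA : G (monomx (vec3 1 1 0) 1%g).
  by apply: (mulG _ _ _ _ _ _ GA GA); elim/ord3_ind; rewrite ?perm1 !cycle12E.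
have GBB : G (monomx (vec3 (-1) 0 (-1)) c2).
  by apply: (mulG _ _ _ _ _ _ GB GB); elim/ord3_ind; rewrite ?c2E !cycle123E.
have GBBB : G (monomx (vec3 (-1) (-1) (-1)) 1%g).
  by apply: (mulG _ _ _ _ _ _ GBB GB); elim/ord3_ind;
    rewrite ?perm1 ?c2E ?cycle123E.
have diagG d1 d2 d3 : G (monomx d1 1%g) -> G (monomx d2 1%g) ->
    (forall i, d1 i + d2 i = d3 i) -> G (monomx d3 1%g).
  by move=> *; apply: (mulG d1 1%g d2 1%g) => // i; rewrite !perm1.
(* The word [A^2 B]. *)
have GC : G (monomx (vec3 0 1 0) cycle123).
  by apply: (mulG _ _ _ _ _ _ GAA GB); elim/ord3_ind;
    rewrite ?perm1 // !cycle123E.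
have GCC : G (monomx (vec3 1 1 0) c2).
  by apply: (mulG _ _ _ _ _ _ GC GC); elim/ord3_ind; rewrite ?c2E !cycle123E.
have GCCC : G (monomx (vec3 1 1 1) 1%g).
  by apply: (mulG _ _ _ _ _ _ GCC GC); elim/ord3_ind;
    rewrite ?perm1 ?c2E ?cycle123E.
have G2' : G (monomx (vec3 0 0 (-1)) 1%g).
  by apply: (diagG _ _ _ GAA GBBB); elim/ord3_ind.
(* [B D B^-1], with [B^-1] obtained as [B^2 (A^2 B)^3]. *)
have conj a b c : G (monomx (vec3 a b c) 1%g) -> G (monomx (vec3 b c a) 1%g).
  move=> Gd.
  have GBd : G (monomx (vec3 (b - 1) c a) cycle123).
    apply: (mulG _ _ _ _ _ _ GB Gd); elim/ord3_ind => /=;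
      by rewrite ?perm1 // cycle123E /vec3 /=; lia.
  have GBdBB : G (monomx (vec3 (b - 1) (c - 1) (a - 1)) 1%g).
    apply: (mulG _ _ _ _ _ _ GBd GBB); elim/ord3_ind => /=;
      by rewrite ?perm1 cycle123E ?c2E // /vec3 /=; lia.
  by apply: (diagG _ _ _ GBdBB GCCC); elim/ord3_ind; rewrite /vec3 /=; lia.
have G0' := conj _ _ _ G2'; have G1' := conj _ _ _ G0'.
have G01' : G (monomx (vec3 (-1) (-1) 0) 1%g).
  by apply: (diagG _ _ _ G0' G1'); elim/ord3_ind.
have G2 : G (monomx (vec3 0 0 1) 1%g).
  by apply: (diagG _ _ _ G01' GCCC); elim/ord3_ind.
have G2x x : G (monomx (vec3 0 0 x) 1%g).
  elim: x => [|n IH|n IH].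
  - by apply: (diagG _ _ _ G2 G2'); elim/ord3_ind.
  - by apply: (diagG _ _ _ IH G2); elim/ord3_ind; rewrite /vec3 //=; lia.
  - by apply: (diagG _ _ _ IH G2'); elim/ord3_ind; rewrite /vec3 //=; lia.
have Gdiag e : G (monomx e 1%g).
  have G1 := conj _ _ _ (G2x (e 1)).
  have G0 := conj _ _ _ (conj _ _ _ (G2x (e 0))).
  have G01 : G (monomx (vec3 (e 0) (e 1) 0) 1%g).
    by apply: (diagG _ _ _ G0 G1); elim/ord3_ind; rewrite /vec3 /=; lia.
  by apply: (diagG _ _ _ G01 (G2x (e ord_max))); elim/ord3_ind;
    rewrite /vec3 /=; lia.
pose K (u : 'S_3) := forall e, G (monomx e u).
have KM u v : K u -> K v -> K (u * v)%g.
  move=> Ku Kv e; apply: (mulG e u (fun=> 0) v) => // i; first by rewrite addr0.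
  by rewrite permM.
(* Diagonal factors turn one weighting of a permutation into any other. *)
have diagK e u : G (monomx e u) -> K u.
  move=> Ge f; apply: (mulG (fun i => f i - e i) 1%g e u) => // i;
    by rewrite perm1 ?subrK.
have K12 : K cycle12 := diagK _ _ GA; have K123 : K cycle123 := diagK _ _ GB.
have Kc2 : K c2 := diagK _ _ GBB; have K1 : K 1%g by [].
have c2V : c2 = (cycle123^-1)%g.
  apply/permP; elim/ord3_ind; apply: (can_inj (permK cycle123));
  by rewrite permKV ?c2E !cycle123E.
have KJ i j : K (tperm i j) -> K (tperm (cycle123 i) (cycle123 j)).
  move=> Kij; rewrite -tpermJ conjgE -c2V.
  exact: (KM _ _ Kc2 (KM _ _ Kij K123)).
have KT i j : K (tperm i j).
  have T01 : K (tperm 0 1) by [].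
  have T12 := KJ _ _ T01; have T20 := KJ _ _ T12; rewrite !cycle123E in T12 T20.
  move: i j; do 2 elim/ord3_ind; rewrite ?tperm1 //; rewrite tpermC; assumption.
have [ts -> _] := prod_tpermP s.
suff: K (\prod_(t <- ts) tperm t.1 t.2)%g by apply.
by apply: big_ind => //; exact: KM.
Qed.

Lemma assoc_generated (G : set 'M[Zmax]_3) : subsemigroup mulM3 G ->
    (forall M, monomial M -> G M) ->
  forall M N, assoc M N -> G M -> G N.
Proof.
move=> cG mG M N [U [V [/mG GU /mG GV ->]]] GM.
exact: cG (cG _ _ GU GM) GV.
Qed.

(** * Clearing entries with transvections *)

Definition transvection n (i j : 'I_n) (c : int) : 'M[Zmax]_n :=
  \matrix_(k, l) if k == l then fin 0
                 else if (k == i) && (l == j) then fin c else ninf.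

Lemma mulmx_transvection n p (M : 'M[Zmax]_(p, n)) i j c k l : i != j ->
  (M *m transvection i j c) k l =
    if l == j then M k j + M k i * fin c else M k l.
Proof.
move=> /negPf ij; rewrite mxE (bigD1 l) //= mxE eqxx mulr1.
case: eqP => [-> | /eqP/negPf lj].
  rewrite (bigD1 i) ?ij //= big1 => [|m /andP[/negPf mj /negPf mi]].
    by rewrite mxE ij !eqxx addr0.
  by rewrite mxE mj mi mulr0.
rewrite big1 ?addr0 // => m /negPf ml.
by rewrite mxE ml lj andbF mulr0.
Qed.

(** Take the largest [c] such that column [i] shifted by [c] stays below
    column [j]. Equality is attained somewhere, and the entries of column [j]
    where it is attained are recovered from column [i], so they may be
    replaced by -oo. *)
Lemma column_reduction n p (M : 'M[Zmax]_(p, n)) i j : i != j ->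
    (exists k, M k i != 0) -> (forall k, M k i != 0 -> M k j != 0) ->
  exists c (M' : 'M_(p, n)) k, [/\ M = M' *m transvection i j c,
    forall k l, M' k l != 0 -> M k l != 0, M k j != 0 & M' k j = 0].
Proof.
move=> ij [k0 k0i] sub.
pose z (x : Zmax) : int := odflt 0 x.
have zE x : x != 0 -> x = fin (z x) by case: x.
case: (@Order.TotalTheory.arg_minP _ _ _ k0 (fun k => M k i != 0)
  (fun k => z (M k j) - z (M k i)) k0i) => k ki kmin.
pose c := z (M k j) - z (M k i).
pose M' := \matrix_(x, y)
  if (y == j) && (M x y == M x i * fin c) then ninf else M x y : Zmax.
exists c, M', k; split; last 2 first.
- exact: sub.
- rewrite mxE eqxx /= [M k j]zE ?sub // [M k i]zE //= /c.
  by rewrite -[fin _ * _]/(fin (_ + _)) addrC subrK eqxx.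
- apply/matrixP => x y; rewrite mulmx_transvection //.
  case: eqP => [->|/eqP/negPf yj]; last by rewrite mxE yj.
  rewrite !mxE eqxx (negPf ij) /=; case: eqP => [-> | neq].
    by rewrite [RHS]add0r.
  case: (eqVneq (M x i) 0) => [-> | xi]; first by rewrite mul0r addr0.
  have := kmin x xi; rewrite -/c.
  move: neq; rewrite [M x i]zE // [M x j]zE ?sub //=.
  set a := z (M x i); set b := z (M x j) => _ lec.
  rewrite -[fin _ * _]/(fin (a + c)) -[RHS]/(fin (Num.max b (a + c))).
  by congr Some; lia.
- by move=> x y; rewrite mxE; case: ifP.
Qed.

Lemma nfin_lt n (M M' : 'M[Zmax]_n) k j :
    (forall k l, M' k l != 0 -> M k l != 0) -> M k j != 0 -> M' k j = 0 ->
  (nfin M' < nfin M)%N.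
Proof.
move=> sub Mkj M'kj; rewrite /nfin !pair_big /=.
rewrite (bigD1 (k, j)) // [X in (_ < X)%N](bigD1 (k, j)) //= Mkj M'kj eqxx.
rewrite add0n add1n ltnS; apply: leq_sum => -[x y] _ /=.
by case: (M' x y != 0) (sub x y) => // ->.
Qed.

(** For a nonzero column [i], the support of column [i] is not contained in
    that of column [j]. The index [k] only witnesses that column [i] is
    nonzero. *)
Definition incomparable_columns n p (M : 'M[Zmax]_(p, n)) : Prop :=
  forall i j k, i != j -> M k i != 0 -> exists2 l, M l i != 0 & M l j = 0.

Lemma perm_to01 n (i j : 'I_n.+2) : i != j ->
  exists s : 'S_n.+2, s i = 0 /\ s j = 1.
Proof.
move=> ij; exists (tperm i 0 * tperm (tperm i 0 j) 1%R)%g.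
rewrite !permM tpermL tpermL; split=> //; apply: tpermD => //.
by rewrite -{2}(tpermL i 0) (inj_eq perm_inj) eq_sym.
Qed.

Lemma transvection_assoc (i j : 'I_3) c : i != j ->
  assoc E12 (transvection i j c).
Proof.
case/perm_to01 => s [s0 s1].
have E12E (x y : 'I_3) : E12 x y =
   if x == y then fin 0 else if (x == 0) && (y == 1) then fin 0 else ninf.
  by move: x y; do 2 elim/ord3_ind; rewrite mxE.
(* Scaling row [i] by [c] and column [i] by [- c] restores the diagonal and
   leaves [c] at position (i, j). *)
apply: (@assocP _ _ _ (fun x => if x == i then c else 0)
  (fun y => if y == i then - c else 0) s s) => x y.
rewrite mxE E12E -s0 -s1 !(inj_eq perm_inj).
case: eqP => [->|/eqP xy].
  by case: eqP => // _; congr Some; lia.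
case: (eqVneq x i) => [xi|] //=; case: (eqVneq y j) => [yj|//].
by rewrite -[RHS]/(fin (_ + _)) ifN ?addr0 //; rewrite -xi eq_sym.
Qed.

Lemma zero_row_idempotent_assoc (i : 'I_3) : assoc (A1 ninf)
  (\matrix_(x, y) if (x == y) && (x != i) then fin 0 else ninf).
Proof.
have A1E (x y : 'I_3) :
    A1 ninf x y = if (x == y) && (x != 0) then fin 0 else ninf.
  by move: x y; do 2 elim/ord3_ind; rewrite mxE.
have [s si] : exists s : 'S_3, s i = 0 by exists (tperm i 0); rewrite tpermL.
apply: (@assocP _ _ _ (fun=> 0) (fun=> 0) s s) => x y.
rewrite mxE A1E -si !(inj_eq perm_inj).
by case: ifP.
Qed.

(** * Partial monomial matrices *)

Definition partial_monomial n (M : 'M[Zmax]_n) : Prop :=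
  (forall i j k, M i j != 0 -> M i k != 0 -> j = k) /\
  (forall i j k, M i k != 0 -> M j k != 0 -> i = j).

Lemma nonzero_row n p (M : 'M[Zmax]_(n, p)) i : row i M != 0 ->
  exists j, M i j != 0.
Proof.
move=> nz; apply: contrapT => Mi0; move: nz; rewrite (_ : row i M = 0) ?eqxx //.
apply/rowP => j; rewrite !mxE; apply: contrapT => Mij.
by apply: Mi0; exists j; apply/eqP.
Qed.

(** If row [i] is -oo, then some column [j] is too, since otherwise choosing a
    finite entry in each column would inject the columns into the rows other
    than [i]. Putting a finite entry at (i, j) and erasing row [i] afterwards
    gives back the matrix, and there is one erased row fewer. Without erased
    rows the matrix is monomial. *)
Lemma partial_monomial_generated (G : set 'M[Zmax]_3) : subsemigroup mulM3 G ->
    (forall M, monomial M -> G M) -> G (A1 ninf) ->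
  forall M, partial_monomial M -> G M.
Proof.
move=> cG mG GA1 M.
have [m] := ubnP #|[set i | row i M == 0]%SET|.
elim: m M => // m IH M; rewrite ltnS => Mm [rowM colM].
case: (pickP (fun i => row i M == 0)) => [i /eqP rowi | rows]; last first.
  have /fin_all_exists[f Mf] i : exists j, M i j != 0.
    by apply: nonzero_row; rewrite rows.
  have f_inj : injective f.
    by move=> i j fij; apply: (colM _ _ (f i)) => //; rewrite fij.
  apply: mG; exists (fun i => odflt 0 (M i (f i))), (perm f_inj).
  apply/matrixP => i j; rewrite mxE permE; case: eqP => [->|/eqP jf].
    by case: (zmax_neq0_fin (Mf i)) => a ->.
  by apply/eqP/negPn/negP => Mij; rewrite (rowM _ _ _ Mij (Mf i)) eqxx in jf.
have Mi0 j : M i j = 0 by move/rowP/(_ j): rowi; rewrite !mxE.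
have [j Mj0] : exists j, forall k, M k j = 0.
  case: (pickP (fun j => row j M^T == 0)) => [j /eqP/rowP colj | cols].
    by exists j => k; have := colj k; rewrite !mxE.
  have /fin_all_exists[g Mg] j : exists k, M k j != 0.
    have [|k] := @nonzero_row _ _ M^T j; first by rewrite cols.
    by rewrite mxE; exists k.
  have g_inj : injective g.
    by move=> j k gjk; apply: (rowM (g j)) => //; rewrite gjk.
  by have := Mg ((perm g_inj)^-1%g i); rewrite -(permE g_inj) permKV Mi0.
pose M' : 'M_3 := \matrix_(x, y) if (x == i) && (y == j) then fin 0 else M x y.
have -> : M =
    (\matrix_(x, y) if (x == y) && (x != i) then fin 0 else ninf) *m M'.
  apply/matrixP => x y; rewrite mxE (bigD1 x) //= big1 => [|k /negPf kx].
    rewrite addr0 !mxE eqxx /=; case: eqP => [->|_] /=; first by rewrite Mi0.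
    by rewrite mul1r.
  by rewrite mxE eq_sym kx mul0r.
apply: (cG).
  exact: (assoc_generated cG mG (zero_row_idempotent_assoc i)).
apply: IH.
  apply: leq_trans Mm; apply: proper_card; apply/properP; split.
    apply/fintype.subsetP => x; rewrite !inE => /eqP/rowP x0.
    apply/eqP/rowP => y.
    by have := x0 y; rewrite !mxE; case: ifP.
  exists i; rewrite !inE ?rowi ?eqxx //.
  by apply/eqP => /rowP/(_ j); rewrite !mxE !eqxx.
split=> x y z; rewrite !mxE.
- case: (x =P i) => [->|_] /=; last exact: rowM.
  by case: (y =P j) => [->|_]; case: (z =P j) => [->|_]; rewrite ?Mi0 ?eqxx.
- case: (z =P j) => [->|_]; rewrite ?andbF ?andbT; last exact: colM.
  by case: (x =P i) => [->|_]; case: (y =P i) => [->|_]; rewrite ?Mj0 ?eqxx.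
Qed.

(** * Matrices whose rows and columns are incomparable *)

Lemma Z3E s (i j : 'I_3) : Z3 s i j =
  if j == i then fin 0
  else if j == ordS i then fin (if i == ord_max then s else 0) else ninf.
Proof. by move: i j; do 2 elim/ord3_ind; rewrite mxE. Qed.

(** The six finite entries lie on a hexagon alternating between rows and
    columns. Row and column scalings act transitively on its labellings with a
    given alternating sum, which is therefore the only parameter left. *)
Lemma Z3_normal_form (M : 'M[Zmax]_3) (s t : 'S_3) (a b c d e f : int) :
    [/\ M (s 0) (t 0) = fin a, M (s 0) (t 1) = fin b
      & M (s 0) (t ord_max) = ninf] ->
    [/\ M (s 1) (t 0) = ninf, M (s 1) (t 1) = fin c
      & M (s 1) (t ord_max) = fin d] ->
    [/\ M (s ord_max) (t 0) = fin f, M (s ord_max) (t 1) = ninf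
      & M (s ord_max) (t ord_max) = fin e] ->
  assoc M (Z3 (b + d + f - (a + c + e))).
Proof.
move=> [m00 m01 m02] [m10 m11 m12] [m20 m21 m22].
(* Fixing the scaling of row 0 to be 0 determines the others, following the
   hexagon through the entries [a], [b], [c], [d], [e] that must become 0. *)
apply: (@assocP _ _ _ (vec3 0 (b - c) (b - c + d - e))
  (vec3 (- a) (- b) (c - d - b)) s t).
by do 2 elim/ord3_ind;
  rewrite mxE ?(m00, m01, m02, m10, m11, m12, m20, m21, m22) //=;
  congr Some; rewrite /vec3 /=; lia.
Qed.

Lemma perm3P (x y z : 'I_3) : x != y -> y != z -> x != z ->
  exists s : 'S_3, [/\ s 0 = x, s 1 = y & s ord_max = z].
Proof.
move=> /eqP xy /eqP yz /eqP xz; pose f (i : 'I_3) := nth x [:: x; y; z] i.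
have f_inj : injective f by do 2 elim/ord3_ind; rewrite /f //= => /esym.
by exists (perm f_inj); rewrite !permE.
Qed.

Lemma third_index (x y z t : 'I_3) : x != y -> z != x -> z != y ->
  t != x -> t != y -> t = z.
Proof.
move: (ltn_ord x) (ltn_ord y) (ltn_ord z) (ltn_ord t); rewrite -!val_eqE /=.
by move=> *; apply: val_inj => /=; lia.
Qed.

(** If some row has two finite entries, in columns [a] and [b], then
    incomparability of these columns produces rows [k] and [l], and
    incomparability of the rows fills in all other entries, up to the pattern
    of [Z3]. Otherwise each row has at most one finite entry, and incomparable
    rows cannot share a column. *)
Lemma incomparable_cases (M : 'M[Zmax]_3) :
    incomparable_columns M -> incomparable_columns M^T ->
  partial_monomial M \/ exists r : nat, assoc M (Z3 r%:Z).
Proof.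
move=> colM rowM'.
have rowM i j k : i != j -> M i k != 0 -> exists2 l, M i l != 0 & M j l = 0.
  move=> ij; have := rowM' i j k ij; rewrite mxE => incomp /incomp[l].
  by rewrite !mxE; exists l.
have [[i [a [b [ab ia ib]]]] | rows] :=
  pselect (exists i a b, [/\ a != b, M i a != 0 & M i b != 0]); last first.
  have uniq_row i j k : M i j != 0 -> M i k != 0 -> j = k.
    move=> ij ik; apply: contrapT => /eqP jk; apply: rows.
    by exists i, j, k.
  left; split=> // i j k ik jk; apply: contrapT => /eqP ij.
  have [l il] := rowM i j k ij ik.
  by rewrite (uniq_row i l k) // => /eqP; rewrite (negPf jk).
right.
have [k ka kb] := colM a b i ab ia.
have [l lb la] := colM b a i (contra_neq (@esym _ _ _) ab) ib.
have ki : k != i by apply: contra_neq ib => <-.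
have li : l != i by apply: contra_neq ia => <-.
have kl : k != l by apply: contra_neq ka => ->.
have [c kc ic] := rowM k i a ki ka.
have ca : c != a by apply: contra_neq ia => <-.
have cb : c != b by apply: contra_neq ib => <-.
have lc : M l c != 0.
  have [c' lc' ic'] := rowM l i b li lb.
  suff <- : c' = c by [].
  by apply: (third_index ab) => //;
    [apply: contra_neq ia | apply: contra_neq ib] => <-.
have [[x iaE] [y ibE]] := (zmax_neq0_fin ia, zmax_neq0_fin ib).
have [[z kaE] [v kcE]] := (zmax_neq0_fin ka, zmax_neq0_fin kc).
have [[u lbE] [w lcE]] := (zmax_neq0_fin lb, zmax_neq0_fin lc).
have [s [s0 s1 s2]] :
    exists s : 'S_3, [/\ s 0 = k, s 1 = i & s ord_max = l].
  by apply: perm3P; rewrite // eq_sym.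
have [s' [s'0 s'1 s'2]] :
    exists s : 'S_3, [/\ s 0 = l, s 1 = i & s ord_max = k].
  by apply: perm3P; rewrite // eq_sym.
have [t [t0 t1 t2]] :
    exists t : 'S_3, [/\ t 0 = c, t 1 = a & t ord_max = b].
  by apply: perm3P.
have [t' [t'0 t'1 t'2]] :
    exists t : 'S_3, [/\ t 0 = c, t 1 = b & t ord_max = a].
  by apply: perm3P; rewrite // eq_sym.
(* Going around the hexagon in the opposite direction negates the alternating
   sum, whence the two sets of row and column orders. *)
have [r0|r0] := leP 0 (z + y + w - (v + x + u)).
  exists (absz (z + y + w - (v + x + u))%R); rewrite gez0_abs //.
  by apply: (Z3_normal_form (s := s) (t := t));
    rewrite ?(s0, s1, s2, t0, t1, t2).
exists (absz (u + x + v - (w + y + z))%R).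
rewrite gez0_abs; last by move: r0; clear; lia.
by apply: (Z3_normal_form (s := s') (t := t'));
  rewrite ?(s'0, s'1, s'2, t'0, t'1, t'2).
Qed.

Lemma comparable_columns n (M : 'M[Zmax]_n) : ~ incomparable_columns M ->
  exists i j c (M' : 'M_n), [/\ i != j, M = M' *m transvection i j c &
    (nfin M' < nfin M)%N].
Proof.
move=> /existsNP[i /existsNP[j /existsNP[k nc]]].
move/not_implyP: nc => [ij /not_implyP[ki sub]].
have {}sub l : M l i != 0 -> M l j != 0.
  by move=> li; apply/eqP => lj; apply: sub; exists l.
have [c [M' [l [defM M'M lj l'j]]]] :=
  column_reduction ij (ex_intro _ k ki) sub.
by exists i, j, c, M'; split=> //; apply: nfin_lt lj l'j.
Qed.

Lemma transvection_tr n (i j : 'I_n) c :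
  (transvection i j c)^T = transvection j i c.
Proof.
by apply/matrixP => x y; rewrite !mxE eq_sym andbC.
Qed.

Lemma all_generated (G : set 'M[Zmax]_3) : subsemigroup mulM3 G ->
    G matA -> G matB -> G E12 -> G (A1 ninf) -> (forall r : nat, G (Z3 r%:Z)) ->
  forall M, G M.
Proof.
move=> cG GA GB GE G0 GZ M.
have mG := monomial_generated cG GA GB; have aG := assoc_generated cG mG.
have tG i j c : i != j -> G (transvection i j c).
  by move=> /transvection_assoc/aG; apply.
have [m] := ubnP (nfin M); elim: m M => // m IH M; rewrite ltnS => Mm.
have [colM|] := pselect (incomparable_columns M); last first.
  case/comparable_columns => i [j [c [M' [ij defM lt]]]].
  rewrite defM; apply: (cG); [by apply: IH; apply: leq_trans Mm | exact: tG].
have [rowM|] := pselect (incomparable_columns M^T); last first.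
  case/comparable_columns => i [j [c [M' [ij defM lt]]]].
  rewrite -[M]trmxK defM trmx_mul transvection_tr.
  apply: (cG); first by apply: tG; rewrite eq_sym.
  by apply: IH; rewrite nfin_tr; apply: leq_trans Mm; rewrite nfin_tr in lt.
have [/(partial_monomial_generated cG mG G0) //|[r]] :=
  incomparable_cases colM rowM.
by move=> /assoc_sym/aG; apply.
Qed.

(** * Prime sets *)

Definition prime_class T (op : T -> T -> T) (C : set T) : Prop :=
  forall x y, C (op x y) -> C x \/ C y.

Lemma generating_meets T (op : SemiGroup.law T) (Y C : set T) x :
  generating op Y -> prime_class op C -> C x -> exists2 y, Y y & C y.
Proof.
move=> genY primeC Cx; apply: contrapT => disj.
have sub : smallest (subsemigroup op) Y `<=` ~` C.
  apply: smallest_sub => [y z nCy nCz /primeC[] //|y Yy Cy].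
  by apply: disj; exists y.
by apply: (sub x) => //; rewrite genY.
Qed.

Lemma irredundant_of_prime T (op : SemiGroup.law T) (X : set T) :
    generating op X ->
    (forall x, X x -> exists C, [/\ prime_class op C, C x &
       forall y, X y -> C y -> y = x]) ->
  irredundant_generating op X.
Proof.
move=> genX sepX; split=> // x Xx gen'; have [C [primeC Cx sep]] := sepX x Xx.
have [y [Xy yx] Cy] := generating_meets gen' primeC Cx.
by apply: yx; apply: sep.
Qed.

(** For an [assoc]-class it suffices to factor the chosen representative: the
    outer monomial factors can be absorbed into [M] and [N]. *)
Lemma prime_assoc n (P : 'M[Zmax]_n.+1) :
    (forall M N, M *m N = P -> assoc P M \/ assoc P N) ->
  prime_class *%R (assoc P).
Proof.
move=> primeP M N [U [V [mU mV defMN]]].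
have [U' [mU' _ U'U]] := monomialV mU; have [V' [mV' VV' _]] := monomialV mV.
have defP : (U' *m M) *m (N *m V') = P.
  rewrite mulmxA -(mulmxA U' M) [M *m N]defMN !mulmxA U'U mul1mx.
  by rewrite -mulmxA VV' mulmx1.
case: (primeP _ _ defP) => aP; [left | right].
  by apply: assoc_trans aP (assoc_sym (assocMl _ mU')).
by apply: assoc_trans aP (assoc_sym (assocMr _ mV')).
Qed.

(** If [M i k] and [N k i] are finite and so are [M j k] and [N k j], then
    both [P i j] and [P j i] are finite. So the hypothesis on [P] makes the
    choice of an intermediate index for each diagonal entry injective, and the
    resulting permutation can be moved to the inside of the product. *)
Lemma aligned_factors n (M N P : 'M[Zmax]_n) :
    M *m N = P -> (forall i, P i i != 0) ->
    (forall i j, P i j != 0 -> P j i != 0 -> i = j) ->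
  exists M' N', [/\ assoc M M', assoc N N', M' *m N' = P,
    forall i, M' i i != 0 /\ N' i i != 0 &
    forall i j, (M' i j != 0) || (N' i j != 0) -> P i j != 0].
Proof.
move=> defP Pii antiP.
have /fin_all_exists[k Mk] i : exists k, M i k != 0 /\ N k i != 0.
  by have := Pii i; rewrite -defP => /mulmx_neq0P[k *]; exists k.
have k_inj : injective k.
  move=> i j kij; have [Mi Ni] := Mk i; have [Mj Nj] := Mk j.
  apply: antiP; rewrite -defP; apply/mulmx_neq0P; exists (k i) => //;
  by rewrite kij.
pose s := perm k_inj.
pose U : 'M_n := monomx (fun=> 0) s; pose V : 'M_n := monomx (fun=> 0) s^-1%g.
have mU : monomial U by do 2 eexists.
have mV : monomial V by do 2 eexists.
have VU : V *m U = 1%:M.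
  by rewrite monomxM mulVg -monomx1; apply: eq_monomx => // i; rewrite addr0.
exists (M *m V), (U *m N).
have M'E i j : (M *m V) i j = M i (k j).
  by rewrite -{1}(permK s j) mulmx_monomx permE mulr1.
have N'E i j : (U *m N) i j = N (k i) j by rewrite monomx_mulmx permE mul1r.
have defP' : M *m V *m (U *m N) = P by rewrite mulmxA -(mulmxA M) VU mulmx1.
have diag i : (M *m V) i i != 0 /\ (U *m N) i i != 0 by rewrite M'E N'E.
split=> //; [exact: assocMr | exact: assocMl | move=> i j].
rewrite -defP' => nz; apply/mulmx_neq0P.
case/orP: nz => nz; first by exists j; rewrite ?nz //; case: (diag j).
by exists i; rewrite ?nz //; case: (diag i).
Qed.

(** The case where the product is the identity, for which the aligned factors
    are diagonal. *)
Lemma monomial_factors n (M N : 'M[Zmax]_n) :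
  monomial (M *m N) -> monomial M /\ monomial N.
Proof.
move=> mMN; have [V [mV _ VMN]] := monomialV mMN.
have I1 i j : (1%:M : 'M[Zmax]_n) i j != 0 -> i = j.
  by rewrite mxE; case: (i =P j).
have I11 i : (1%:M : 'M[Zmax]_n) i i != 0 by rewrite mxE eqxx.
have VMN1 : (V *m M) *m N = 1%:M by rewrite -mulmxA.
have [M' [N' [aM aN _ diag sup]]] :=
  aligned_factors VMN1 I11 (fun i j ij _ => I1 i j ij).
have mM' : monomial M'.
  apply: diag_monomial => [i|i j ij]; first by case: (diag i).
  by apply: I1; apply: sup; rewrite ij.
have mN' : monomial N'.
  apply: diag_monomial => [i|i j ij]; first by case: (diag i).
  by apply: I1; apply: sup; rewrite ij orbT.
split; last exact: assoc_monomial (assoc_sym aN) mN'.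
apply: assoc_monomial mM'; apply: assoc_sym; apply: assoc_trans aM.
exact: assocMl.
Qed.

Definition weight_class n (p : pred int) : set 'M[Zmax]_n :=
  [set M | exists d s, M = monomx d s /\ p (\sum_i d i)].

(** Total weight is a morphism from the monomial group to the integers, and
    the factors of a monomial matrix are monomial. *)
Lemma prime_weight_class n (p : pred int) :
    (forall a b : int, p (a + b) -> p a || p b) ->
  prime_class *%R (@weight_class n.+1 p).
Proof.
move=> pD M N [f [u [defMN pf]]].
have [|[d [s defM]] [e [t defN]]] := @monomial_factors _ M N.
  by exists f, u.
have : monomx f u = monomx d s *m monomx e t by rewrite -defM -defN -defMN.
rewrite monomxM => /monomx_inj fE.
move: pf; rewrite (eq_bigr _ (fun i _ => fE i)) big_split /=.
have -> : \sum_i e (s i) = \sum_i e i by rewrite [RHS](reindex_perm s).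
by move=> /pD/orP[pd|pe]; [left | right]; do 2 eexists; split; eauto.
Qed.

Lemma prime_zero_row n :
  prime_class *%R [set M : 'M[Zmax]_n.+1 | exists i, row i M = 0].
Proof.
move=> M N [i MNi]; have [Mi|/nonzero_row[k Mik]] := eqVneq (row i M) 0.
  by left; exists i.
right; exists k; apply/rowP => j; rewrite !mxE; apply/eqP/negPn/negP => Nkj.
have: row i (M *m N) 0 j != 0 by rewrite mxE; apply/mulmx_neq0P; exists k.
by rewrite [row i _]MNi mxE eqxx.
Qed.

Lemma E12_neq0 (i j : 'I_3) : (E12 i j != 0) = (i == j) || (i == 0) && (j == 1).
Proof. by move: i j; do 2 elim/ord3_ind; rewrite mxE. Qed.

Lemma E12_pattern (M : 'M[Zmax]_3) :
  (forall i j, (M i j != 0) = (E12 i j != 0)) -> assoc E12 M.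
Proof.
move=> ME; pose z i j : int := odflt 0 (M i j).
apply: (@assocP _ _ _ (vec3 (z 0 1) (z 1 1) (z ord_max ord_max))
  (vec3 (z 0 0 - z 0 1) 0 0) 1%g 1%g) => i j.
rewrite !perm1.
have M0 x y : E12 x y == 0 -> M x y = 0.
  by move=> E0; apply/eqP; rewrite -[_ == _]negbK ME negbK.
have Mz x y : E12 x y != 0 -> M x y = fin (z x y).
  by rewrite -ME /z; case: (M x y).
move: i j; do 2 elim/ord3_ind;
  (rewrite Mz; last by rewrite mxE) || (rewrite M0; last by rewrite mxE);
  rewrite mxE //=; congr Some; rewrite /vec3 /=; lia.
Qed.

(** The aligned factors are diagonal except possibly at (0, 1). If both were
    -oo there, so would be their product. *)
Lemma prime_E12 (M N : 'M[Zmax]_3) : M *m N = E12 -> assoc E12 M \/ assoc E12 N.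
Proof.
move=> defE.
have [i|i j|M' [N' [aM aN defE' diag sup]]] := aligned_factors defE.
- by rewrite E12_neq0 eqxx.
- by rewrite !E12_neq0; move: i j; do 2 elim/ord3_ind.
have diagM i : M' i i != 0 by case: (diag i).
have diagN i : N' i i != 0 by case: (diag i).
suff [a01|a01] : M' 0 1 != 0 \/ N' 0 1 != 0.
- left; apply: assoc_trans (assoc_sym aM); apply: E12_pattern => i j.
  apply/idP/idP => [ij|]; first by apply: sup; rewrite ij.
  by rewrite E12_neq0 => /orP[/eqP->|/andP[/eqP-> /eqP->]].
- right; apply: assoc_trans (assoc_sym aN); apply: E12_pattern => i j.
  apply/idP/idP => [ij|]; first by apply: sup; rewrite ij orbT.
  by rewrite E12_neq0 => /orP[/eqP->|/andP[/eqP-> /eqP->]].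
have /mulmx_neq0P[k Mk Nk] : (M' *m N') 0 1 != 0 by rewrite defE' E12_neq0.
have := sup 0 k; rewrite Mk E12_neq0 => /(_ isT).
case/orP => [/eqP k0|/andP[_ /eqP k1]]; first by right; rewrite k0.
by left; rewrite -k1.
Qed.

Lemma Z3_neq0 r (i j : 'I_3) : (Z3 r i j != 0) = (j == i) || (j == ordS i).
Proof. by rewrite Z3E; case: (j == i) => //; case: (j == _). Qed.

(** The aligned factors [M'] and [N'] are supported on the diagonal and the
    cycle [i -> i + 1]. Each edge of the cycle is in [M'] or in [N'], but an
    edge of [M'] cannot be followed by an edge of [N'], because [i -> i + 2]
    is -oo in the product. So as soon as [M'] has an edge it has the next one
    too, hence all of them, and then [N'] has none: one of the factors is
    diagonal. *)
Lemma prime_Z3 r (M N : 'M[Zmax]_3) :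
  M *m N = Z3 r -> assoc (Z3 r) M \/ assoc (Z3 r) N.
Proof.
move=> defZ.
have [i|i j|M' [N' [aM aN defZ' diag sup]]] := aligned_factors defZ.
- by rewrite Z3_neq0 eqxx.
- by rewrite !Z3_neq0; move: i j; do 2 elim/ord3_ind.
have diagM i : M' i i != 0 by case: (diag i).
have diagN i : N' i i != 0 by case: (diag i).
have supM i j : M' i j != 0 -> (j == i) || (j == ordS i).
  by rewrite -(Z3_neq0 r) => ij; apply: sup; rewrite ij.
have supN i j : N' i j != 0 -> (j == i) || (j == ordS i).
  by rewrite -(Z3_neq0 r) => ij; apply: sup; rewrite ij orbT.
have cover i : (M' i (ordS i) != 0) || (N' i (ordS i) != 0).
  have /mulmx_neq0P[k Mk Nk] : (M' *m N') i (ordS i) != 0.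
    by rewrite defZ' Z3_neq0 eqxx orbT.
  by case/orP: (supM i k Mk) => /eqP kE; rewrite kE in Mk Nk;
    rewrite ?Mk ?Nk ?orbT.
have excl i : M' i (ordS i) != 0 -> N' (ordS i) (ordS (ordS i)) = 0.
  move=> Mi; apply/eqP/negPn/negP => Ni.
  have: (M' *m N') i (ordS (ordS i)) != 0 by apply/mulmx_neq0P; exists (ordS i).
  by rewrite defZ' Z3_neq0; move: i {Mi Ni}; elim/ord3_ind.
have [M0|N0] : (forall i, M' i (ordS i) = 0) \/ (forall i, N' i (ordS i) = 0).
- have ordS3 (i : 'I_3) : ordS (ordS (ordS i)) = i.
    by apply: val_inj; move: i; elim/ord3_ind.
  have step i : M' i (ordS i) != 0 -> M' (ordS i) (ordS (ordS i)) != 0.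
    by move=> Mi; have := cover (ordS i); rewrite (excl _ Mi) eqxx orbF.
  have [[i Mi]|M0] := pselect (exists i, M' i (ordS i) != 0); last first.
    left=> i; apply/eqP/negPn/negP => Mi; apply: M0; exists i; exact: Mi.
  right=> j.
  have Mj2 k : M' k (ordS k) != 0.
    have : [|| k == i, k == ordS i | k == ordS (ordS i)].
      by move: {Mi} i k; do 2 elim/ord3_ind.
    by case/or3P => /eqP->; rewrite ?step.
  by rewrite -[j]ordS3; apply: excl.
- right; apply: assoc_trans (assoc_sym aN); apply: assoc_sym.
  rewrite -defZ'; apply: assocMl; apply: diag_monomial => // i j ij.
  by case/orP: (supM i j ij) => /eqP ji //; rewrite ji M0 eqxx in ij.
- left; apply: assoc_trans (assoc_sym aM); apply: assoc_sym.
  rewrite -defZ'; apply: assocMr; apply: diag_monomial => // i j ij.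
  by case/orP: (supN i j ij) => /eqP ji //; rewrite ji N0 eqxx in ij.
Qed.

(** * Separating the matrices [Z3 r] *)

Definition perm_weight n (M : 'M[Zmax]_n) (p : 'S_n) : Zmax :=
  \prod_i M i (p i).

(** Monomial factors permute the permutation weights and shift them all by the
    same amount, so the differences between the finite ones are invariants of
    [assoc]. *)
Definition weight_gap n (M : 'M[Zmax]_n) : set int :=
  [set x | exists p q a,
    perm_weight M p = fin a /\ perm_weight M q = fin (a + x)].

Lemma prod_fin n (d : 'I_n -> int) : \prod_i fin (d i) = fin (\sum_i d i).
Proof.
by elim/big_rec2: _ => // i x y _ ->.
Qed.

Lemma weight_gap_assoc n (M N : 'M[Zmax]_n) :
  assoc M N -> weight_gap M `<=` weight_gap N.
Proof.
case/assoc_entries => d [e [s [t defN]]] x [p [q [a [Mp Mq]]]].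
have wN r : perm_weight N (s * r * t) =
    fin (\sum_i d i) * perm_weight M r * fin (\sum_i e i).
  rewrite /perm_weight -!prod_fin [X in _ * X * _](reindex_perm s).
  rewrite [X in _ * X](reindex_perm (s * r)%g) -!big_split /=.
  by apply: eq_bigr => i _; rewrite !permM defN.
exists (s * p * t)%g, (s * q * t)%g, (\sum_i d i + a + \sum_i e i).
by rewrite !wN Mp Mq; split=> //; congr Some; lia.
Qed.

(** The only two permutations in the support of [Z3 r] are the identity, of
    weight 0, and the 3-cycle, of weight [r]. *)
Lemma Z3_weight r p a : perm_weight (Z3 r) p = fin a -> a = 0 \/ a = r.
Proof.
have -> : perm_weight (Z3 r) p =
    Z3 r 0 (p 0) * Z3 r 1 (p 1) * Z3 r ord_max (p ord_max).
  rewrite /perm_weight 3!big_ord_recr big_ord0 /= mul1r.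
  by do 2! [congr (_ * _)];
    (rewrite (_ : widen_ord _ _ = 0); last exact: val_inj)
    || (rewrite (_ : widen_ord _ _ = 1); last exact: val_inj) || idtac.
move: (p 0) (p 1) (p ord_max); do 3 elim/ord3_ind; rewrite !mxE //= => -[<-];
  by rewrite ?addr0 ?add0r; auto.
Qed.

Lemma Z3_gap r : weight_gap (Z3 r) r.
Proof.
exists 1%g, cycle123, 0; rewrite /perm_weight !big_ord_recl !big_ord0.
by rewrite !permE !mxE /=; split; congr Some; lia.
Qed.

(** Nonnegativity is essential: the gaps of [Z3 r] are 0, [r] and [- r]. *)
Lemma Z3_assoc_inj (r t : nat) : assoc (Z3 r%:Z) (Z3 t%:Z) -> r = t.
Proof.
move=> art; have atr := assoc_sym art.
have := weight_gap_assoc art (Z3_gap r).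
have := weight_gap_assoc atr (Z3_gap t).
move=> [p [q [a [/Z3_weight ap /Z3_weight aq]]]].
move=> [p' [q' [a' [/Z3_weight ap' /Z3_weight aq']]]].
lia.
Qed.

(** * Separating the generators *)

Lemma nfin_E12 : nfin E12 = 4.
Proof. by rewrite /nfin !big_ord_recl !big_ord0 !mxE. Qed.
Lemma nfin_A1 : nfin (A1 ninf) = 2.
Proof. by rewrite /nfin !big_ord_recl !big_ord0 !mxE. Qed.
Lemma nfin_Z3 r : nfin (Z3 r) = 6.
Proof. by rewrite /nfin !big_ord_recl !big_ord0 !mxE. Qed.

Definition generators : set 'M[Zmax]_3 :=
  [set matA; matB; E12; A1 ninf] `|` [set Z3 i%:Z | i in [set: nat]].

Lemma weight_class_nfin n p (M : 'M[Zmax]_n) : weight_class p M -> nfin M = n.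
Proof. by move=> [d [s [-> _]]]; apply: nfin_monomial; do 2 eexists. Qed.

Lemma weight_class_matA p : weight_class p matA -> p 1.
Proof.
move=> [d [s [dA]]]; rewrite matAE in dA.
by rewrite -(eq_bigr _ (fun i _ => monomx_inj dA i)) !big_ord_recl big_ord0.
Qed.

Lemma weight_class_matB p : weight_class p matB -> p (-1).
Proof.
move=> [d [s [dA]]]; rewrite matBE in dA.
by rewrite -(eq_bigr _ (fun i _ => monomx_inj dA i)) !big_ord_recl big_ord0.
Qed.

Lemma nfin_matA : nfin matA = 3.
Proof. by rewrite matAE; apply: nfin_monomial; do 2 eexists. Qed.
Lemma nfin_matB : nfin matB = 3.
Proof. by rewrite matBE; apply: nfin_monomial; do 2 eexists. Qed.

Lemma monomial_row n (M : 'M[Zmax]_n) i : monomial M -> row i M != 0.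
Proof.
move=> [d [s ->]]; apply/eqP => /rowP/(_ (s i)).
by rewrite !mxE eqxx.
Qed.

Lemma diag_row n (M : 'M[Zmax]_n) i : M i i != 0 -> row i M != 0.
Proof.
move=> Mii; apply/eqP => /rowP/(_ i).
by rewrite !mxE => /eqP; rewrite (negPf Mii).
Qed.

Definition nfinE := (nfin_matA, nfin_matB, nfin_E12, nfin_A1, nfin_Z3).

Lemma generators_separated x : generators x -> exists C,
  [/\ prime_class *%R C, C x & forall y, generators y -> C y -> y = x].
Proof.
move=> [[[[->|->]|->]|->]|[r _ <-]].
- exists (weight_class (fun a => 0 < a)); split.
  + by apply: prime_weight_class => a b; lia.
  + exists (vec3 1 0 0), cycle12.
    split; first exact: matAE.
    by rewrite !big_ord_recl big_ord0.
  + move=> y [[[[->|->]|->]|->]|[t _ <-]] // Cy;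
      by [move/weight_class_matB: Cy
         | move/weight_class_nfin: Cy; rewrite nfinE].
- exists (weight_class (fun a => a < 0)); split.
  + by apply: prime_weight_class => a b; lia.
  + exists (vec3 (-1) 0 0), cycle123.
    split; first exact: matBE.
    by rewrite !big_ord_recl big_ord0.
  + move=> y [[[[->|->]|->]|->]|[t _ <-]] // Cy;
      by [move/weight_class_matA: Cy
         | move/weight_class_nfin: Cy; rewrite nfinE].
- exists (assoc E12); split.
  + exact: prime_assoc prime_E12.
  + exact: assoc_refl.
  + by move=> y [[[[->|->]|->]|->]|[t _ <-]] // /nfin_assoc; rewrite !nfinE.
- exists [set M | exists i, row i M = 0]; split.
  + exact: prime_zero_row.
  + by exists 0; apply/rowP => j; rewrite !mxE; move: j; elim/ord3_ind.
  + move=> y [[[[->|->]|->]|->]|[t _ <-]] // [i /eqP]; apply: contraTeq => _.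
    * by apply: monomial_row; rewrite matAE; do 2 eexists.
    * by apply: monomial_row; rewrite matBE; do 2 eexists.
    * by apply: diag_row; rewrite E12_neq0 eqxx.
    * by apply: diag_row; rewrite Z3_neq0 eqxx.
- exists (assoc (Z3 r%:Z)); split.
  + exact/prime_assoc/prime_Z3.
  + exact: assoc_refl.
  + move=> y [[[[->|->]|->]|->]|[t _ <-]];
      try by move/nfin_assoc; rewrite !nfinE.
    by move/Z3_assoc_inj->.
Qed.

Lemma generators_generate : generating mulM3 generators.
Proof.
apply/seteqP; split=> // M _ S [subS genS].
by apply: (all_generated subS) => *; apply: genS; rewrite /generators /=;
  [do 3 left; left | do 3 left; right | do 2 left; right
  | left; right | right; eexists].
Qed.

(** The map sending a matrix to the [r] for which it is associated to [Z3 r]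
    is onto already from a generating set. *)
Lemma infinite_generating (Y : set 'M[Zmax]_3) :
  generating mulM3 Y -> ([set: nat] #<= Y)%card.
Proof.
move=> genY.
pose index (M : 'M[Zmax]_3) : nat := xget 0%N [set r : nat | assoc (Z3 r%:Z) M].
suff <- : index @` Y = setT by apply: card_image_le.
apply/seteqP; split=> // r _.
have [M YM rM] :=
  generating_meets genY (prime_assoc (@prime_Z3 r)) (assoc_refl _).
exists M => //; apply: xget_unique => // t tM.
exact: Z3_assoc_inj (assoc_trans tM (assoc_sym rM)).
Qed.

Theorem corollary4p13 :
  minimally_irredundantly_generated_by
    ( *%R : SemiGroup.law 'M[Zmax]_3)
    ([set matA; matB; E12; A1 ninf] `|` [set Z3 i%:Z | i in [set: nat]]).
Proof.
split.
  split=> [|Y genY]; first exact: generators_generate.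
  exact: card_le_trans (countableP _) (infinite_generating genY).
exact: irredundant_of_prime generators_generate generators_separated.
Qed.
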